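(* For each number $n\in\mathbb N$, the Kruskal derivative of $\mathsf S^0_n$ is given by $(\mathsf S^0_{n+1},\iota^n,\kappa^n)$, i.e. this tuple is a Kruskal derivative of the normal $\mathsf{PO}$-dilator $\mathsf S^0_n$. Here $\iota^n$ and $\kappa^n$ denote the families of functions $\iota^n_X:X\to\mathsf S^0_{n+1}(X)$ and $\kappa^n_X:\mathsf S^0_n(\mathsf S^0_{n+1}(X))\to\mathsf S^0_{n+1}(X)$, indexed by the partial order $X$, that are defined in the context.
   Context: Term systems: given a partial order $X$, a set $\mathsf S(X)$ of terms and a function $S:\mathsf S(X)\to\mathbb N\cup\{-1\}$ are generated by simultaneous recursion: (i) for each $x\in X$ there is a term $\overline x\in\mathsf S(X)$ with $S(\overline x)=-1$; (ii) given $s\in\mathsf S(X)$ and $i\in\mathbb N$ with $i\geq\max\{S(s)-1,0\}$, there is a term $\vartheta_is\in\mathsf S(X)$ with $S(\vartheta_is)=i$. For $i\in\mathbb N\cup\{-1\}$ define $k_i:\mathsf S(X)\to\mathsf S(X)$ by $k_i(\overline x)=\overline x$, $k_i(\vartheta_js)=\vartheta_js$ if $j\leq i$, and $k_i(\vartheta_js)=k_i(s)$ if $j>i$. The relation $s\leq_{\mathsf S(X)}t$ holds if and only if one of the following applies: (i') $s=\overline x$, $t=\overline y$ and $x\leq_Xy$; (ii') $t=\vartheta_jt'$ and $s\leq_{\mathsf S(X)}k_j(t')$; (iii') $s=\vartheta_is'$ and $t=\vartheta_it'$ (same $i$) with $s'\leq_{\mathsf S(X)}t'$. This is a partial order. $\mathsf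 S_n(X)\subseteq\mathsf S(X)$ consists of the terms that contain only indices $i<n$, and $\mathsf S^0_n(X)=\{s\in\mathsf S_n(X)\mid S(s)\leq 0\}$, with the restricted order. Dilator structure: $k_{-1}(s)$ always has the form $\overline x$ with $x\in X$; put $\underline k(s)=x$ if $k_{-1}(s)=\overline x$. For a quasi embedding $f:X\to Y$ define $\mathsf S(f)(\overline x)=\overline{f(x)}$ and $\mathsf S(f)(\vartheta_is)=\vartheta_i\mathsf S(f)(s)$, and let $\mathsf S^0_n(f):\mathsf S^0_n(X)\to\mathsf S^0_n(Y)$ be the restriction. Put $\operatorname{supp}_X(s)=\{\underline k(s)\}$. This makes $\mathsf S^0_n$ a normal $\mathsf{PO}$-dilator. Functions: define $\sigma^n_X:\mathsf S_n(\mathsf S^0_{n+1}(X))\to\mathsf S_{n+1}(X)$ by $\sigma^n_X(\overline r)=r$ for $r\in\mathsf S^0_{n+1}(X)$ and $\sigma^n_X(\vartheta_is)=\vartheta_{i+1}\sigma^n_X(s)$. Define $\kappa^n_X:\mathsf S^0_n(\mathsf S^0_{n+1}(X))\to\mathsf S^0_{n+1}(X)$ by $\kappa^n_X(s)=\vartheta_0\sigma^n_X(s)$ and $\iota^n_X:X\to\mathsf S^0_{n+1}(X)$ by $\iota^n_X(x)=\overline x$. General notions: $[X]^{<\omega}$ is the set of finite subsets of $X$, with $[f]^{<\omega}(a)=\{f(x)\mid x\in a\}$; $\operatorname{rng}$ denotes the image. A function $f:X\to Y$ between partial orders is a quasi embedding if $f(x)\leq_Yf(x')$ implies $x\leq_Xx'$;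 it is an embedding if the converse implication holds as well. $\mathsf{PO}$ is the category of partial orders with quasi embeddings as morphisms. A $\mathsf{PO}$-dilator consists of a functor $W:\mathsf{PO}\to\mathsf{PO}$ such that $W(f)$ is an embedding whenever $f$ is an embedding, and a natural transformation $\operatorname{supp}^W:W\Rightarrow[\cdot]^{<\omega}$ such that, for any embedding $f:X\to Y$ and $\sigma\in W(Y)$, $\operatorname{supp}^W_Y(\sigma)\subseteq\operatorname{rng}(f)$ implies $\sigma\in\operatorname{rng}(W(f))$. It is normal if $\sigma\leq_{W(X)}\tau$ implies that each $x\in\operatorname{supp}^W_X(\sigma)$ admits an $x'\in\operatorname{supp}^W_X(\tau)$ with $x\leq_Xx'$. A Kruskal fixed point of a normal $\mathsf{PO}$-dilator $W$ over a partial order $X$ consists of a partial order $Z$ and functions $\iota:X\to Z$ and $\kappa:W(Z)\to Z$ such that, for all $x,y\in X$ and $\sigma,\tau\in W(Z)$: $\iota(x)\leq_Z\iota(y)\Leftrightarrow x\leq_Xy$; $\iota(x)\leq_Z\kappa(\tau)\Leftrightarrow\iota(x)\leq_Zz$ for some $z\in\operatorname{supp}^W_Z(\tau)$; $\kappa(\sigma)\not\leq_Z\iota(y)$; $\kappa(\sigma)\leq_Z\kappa(\tau)\Leftrightarrow\sigma\leq_{W(Z)}\tau$ or $\kappa(\sigma)\leq_Zz$ for some $z\in\operatorname{supp}^W_Z(\tau)$. It is initial if for any Kruskal fixed point $(Z',\iota',\kappa')$ of $W$ over $X$ there is a unique quasi embedding $f:Z\to Z'$ with $f\circ\iota=\iota'$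 and $f\circ\kappa=\kappa'\circ W(f)$. (Known criterion: a Kruskal fixed point $(Z,\iota,\kappa)$ is initial if and only if $Z=\operatorname{rng}(\iota)\cup\operatorname{rng}(\kappa)$ and there is $h:Z\to\mathbb N$ with $h(z)<h(\kappa(\sigma))$ for all $\sigma\in W(Z)$ and $z\in\operatorname{supp}^W_Z(\sigma)$.) A Kruskal derivative of $W$ consists of a normal $\mathsf{PO}$-dilator $V$ and families of functions $\iota_X:X\to V(X)$ and $\kappa_X:W(V(X))\to V(X)$, indexed by partial orders $X$, such that each $(V(X),\iota_X,\kappa_X)$ is an initial Kruskal fixed point of $W$ over $X$, and such that for any quasi embedding $f:X\to Y$ we have $V(f)\circ\iota_X=\iota_Y\circ f$ and $V(f)\circ\kappa_X=\kappa_Y\circ W(V(f))$. *)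

(* Defs.v *)
From mathcomp Require Import all_boot all_order all_algebra.
From mathcomp Require Import zify.
From mathcomp Require Import boolp classical_sets functions cardinality.
From Stdlib Require Import Relation_Definitions.

Set Implicit Arguments.
Unset Strict Implicit.
Unset Printing Implicit Defensive.

Import Order.TTheory GRing.Theory Num.Theory.

Local Open Scope classical_set_scope.
Local Open Scope ring_scope.

(* Orders are Prop-valued on arbitrary types: unlike for [porderType],
   neither decidability nor a choice operator is required. *)
Record PO := MkPO {
  PO_car :> Type;
  PO_le : relation PO_car;
  PO_order : Relation_Definitions.order PO_car PO_le
}.

Notation "x ⊑ y" := (PO_le x y) (at level 70, no associativity).

Definition quasi_embedding (X Y : PO) (f : X -> Y) : Prop :=
  forall x x' : X, f x ⊑ f x' -> x ⊑ x'.

Definition embedding (X Y : PO) (f : X -> Y) : Prop :=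
  forall x x' : X, f x ⊑ f x' <-> x ⊑ x'.

Record qemb (X Y : PO) := MkQemb {
  qemb_fun :> X -> Y;
  qemb_quasi : quasi_embedding qemb_fun
}.

Definition qemb_id (X : PO) : qemb X X :=
  @MkQemb X X (fun x => x) (fun _ _ h => h).

Definition qemb_comp (X Y Z : PO) (g : qemb Y Z) (f : qemb X Y) : qemb X Z :=
  @MkQemb X Z (fun x => g (f x))
    (fun _ _ h => qemb_quasi (qemb_quasi h)).

(* [dil_supp] and [dil_supp_finite] together give the maps into finite subsets. *)
Record PO_dilator := MkDilator {
  dil_obj :> PO -> PO;
  dil_map : forall X Y : PO, qemb X Y -> qemb (dil_obj X) (dil_obj Y);
  dil_supp : forall X : PO, dil_obj X -> set X;
  dil_map_id : forall X : PO, dil_map (qemb_id X) =1 id;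
  dil_map_comp : forall (X Y Z : PO) (g : qemb Y Z) (f : qemb X Y),
    dil_map (qemb_comp g f) =1 dil_map g \o dil_map f;
  dil_map_embedding : forall (X Y : PO) (f : qemb X Y),
    embedding f -> embedding (dil_map f);
  dil_supp_finite : forall (X : PO) (s : dil_obj X), finite_set (dil_supp s);
  dil_supp_natural : forall (X Y : PO) (f : qemb X Y) (s : dil_obj X),
    dil_supp (dil_map f s) = f @` dil_supp s;
  dil_supp_range : forall (X Y : PO) (f : qemb X Y) (s : dil_obj Y),
    embedding f -> dil_supp s `<=` range f -> range (dil_map f) s
}.

Definition normal (W : PO_dilator) : Prop :=
  forall (X : PO) (s t : W X), s ⊑ t ->
    forall x, dil_supp s x -> exists2 x', dil_supp t x' & x ⊑ x'.

Record normal_PO_dilator := MkNormalDilator {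
  ndil :> PO_dilator;
  ndil_normal : normal ndil
}.

Record kruskal_fixed_point (W : normal_PO_dilator) (X Z : PO)
    (iota : X -> Z) (kappa : W Z -> Z) : Prop := MkKruskalFixedPoint {
  kfp_iota_iota : forall x y : X, iota x ⊑ iota y <-> x ⊑ y;
  kfp_iota_kappa : forall (x : X) (t : W Z),
    iota x ⊑ kappa t <-> exists2 z, dil_supp t z & iota x ⊑ z;
  kfp_kappa_iota : forall (s : W Z) (y : X), ~ (kappa s ⊑ iota y);
  kfp_kappa_kappa : forall s t : W Z,
    kappa s ⊑ kappa t <->
      (s ⊑ t \/ exists2 z, dil_supp t z & kappa s ⊑ z)
}.

Definition fixed_point_morphism (W : normal_PO_dilator) (X Z Z' : PO)
    (iota : X -> Z) (kappa : W Z -> Z) (iota' : X -> Z') (kappa' : W Z' -> Z')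
    (f : qemb Z Z') : Prop :=
  f \o iota =1 iota' /\ f \o kappa =1 kappa' \o dil_map W f.

Definition initial_kruskal_fixed_point (W : normal_PO_dilator) (X Z : PO)
    (iota : X -> Z) (kappa : W Z -> Z) : Prop :=
  kruskal_fixed_point iota kappa /\
  forall (Z' : PO) (iota' : X -> Z') (kappa' : W Z' -> Z'),
    kruskal_fixed_point iota' kappa' ->
    exists2 f : qemb Z Z',
      fixed_point_morphism iota kappa iota' kappa' f &
      forall g : qemb Z Z',
        fixed_point_morphism iota kappa iota' kappa' g -> g =1 f.

Definition is_kruskal_derivative (W V : normal_PO_dilator)
    (iota : forall X : PO, X -> V X) (kappa : forall X : PO, W (V X) -> V X) :
    Prop :=
  (forall X : PO, initial_kruskal_fixed_point (iota X) (kappa X)) /\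
  (forall (X Y : PO) (f : qemb X Y),
     dil_map V f \o iota X =1 iota Y \o f /\
     dil_map V f \o kappa X =1 kappa Y \o dil_map W (dil_map V f)).

(* The simultaneous recursion that generates terms and their degree is split:
   [term] are raw terms, [wf] singles out those that are actually generated.
   The operations and the order below only refer to subterms, so that they
   restrict to well-formed terms. *)
Inductive term (X : Type) : Type :=
| bar of X
| theta of nat & term X.

Arguments theta {X}.

Definition deg (X : Type) (s : term X) : int :=
  if s is theta i _ then i%:Z else -1.

Fixpoint wf (X : Type) (s : term X) : bool :=
  if s is theta i s' then (Num.max (deg s' - 1) 0 <= i%:Z) && wf s' else true.

(* The intended arguments are [i >= -1]. *)
Fixpoint term_k (X : Type) (i : int) (s : term X) : term X :=
  match s with
  | bar x => bar x
  | theta j s' => if j%:Z <= i then theta j s' else term_k i s'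
  end.

(* An inductive definition is adequate since [term_k j t] is smaller than
   [theta j t]: there is exactly one relation that satisfies the clauses as an
   equivalence. *)
Inductive term_le (X : PO) : term X -> term X -> Prop :=
| term_le_bar (x y : X) : x ⊑ y -> term_le (bar x) (bar y)
| term_le_k (s : term X) (j : nat) (t : term X) :
    term_le s (term_k j%:Z t) -> term_le s (theta j t)
| term_le_theta (i : nat) (s t : term X) :
    term_le s t -> term_le (theta i s) (theta i t).

Fixpoint term_size (X : Type) (s : term X) : nat :=
  if s is theta _ s' then (term_size s').+1 else 0%N.

Lemma term_size_k (X : Type) i (s : term X) : (term_size (term_k i s) <= term_size s)%N.
Proof. by elim: s => //= j s IH; case: ifP => // _; apply: leqW. Qed.

Lemma k_k (X : Type) (i j : int) (s : term X) :
  term_k i (term_k j s) = term_k (Num.min i j) s.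
Proof.
elim: s => //= l s IH; rewrite le_min.
case: (lerP l%:Z j) => /= lj; last by rewrite andbF.
rewrite andbT; case: (lerP l%:Z i) => //= li.
by rewrite min_l // ltW // (lt_le_trans li).
Qed.

Lemma term_le_size (X : PO) (s t : term X) :
  term_le s t -> (term_size s <= term_size t)%N.
Proof.
elim=> //= {}s j {}t _ IH.
by apply: leqW; apply: leq_trans IH (term_size_k _ _).
Qed.

Lemma term_le_mono_k (X : PO) (i : int) (s t : term X) :
  term_le s t -> term_le (term_k i s) (term_k i t).
Proof.
elim=> [x y xy|{}s j {}t _ IH|j {}s {}t st IH] /=; first exact: term_le_bar.
- move: IH; rewrite k_k; case: ifP => ji IH.
    by apply: term_le_k; move: IH; rewrite min_r.
  by move: IH; rewrite min_l // ltW // ltNge ji.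
- by case: ifP => // _; apply: term_le_theta.
Qed.

Lemma term_le_refl (X : PO) (s : term X) : term_le s s.
Proof.
elim: s => [x|i s IH]; last exact: term_le_theta.
by apply: term_le_bar; case: (PO_order X) => r _ _; apply: r.
Qed.

Lemma term_le_trans (X : PO) (s t u : term X) :
  term_le s t -> term_le t u -> term_le s u.
Proof.
have [m] := ubnP (term_size s + term_size t + term_size u)%N.
elim: m s t u => // m IH s t u sz st tu.
case: tu sz st => [x y xy|{}t j {}u tu|i {}t {}u tu] /= sz st.
- inversion st; subst; apply: term_le_bar.
  by case: (PO_order X) => _ tr _; apply: tr xy.
- apply: term_le_k; apply: (IH _ t) => //.
  by have := term_size_k j%:Z u; lia.
- inversion st; subst.
  + apply: term_le_k; apply: (IH _ (term_k i%:Z t)) => //; last exact: term_le_mono_k.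
    by have := term_size_k i%:Z u; have := term_size_k i%:Z t; lia.
  + apply: term_le_theta; apply: (IH _ t) => //.
    by move: sz => /=; lia.
Qed.

Lemma term_le_antisym (X : PO) (s t : term X) :
  term_le s t -> term_le t s -> s = t.
Proof.
elim=> [x y xy|{}s j {}t st _|i {}s {}t st IH] ts.
- inversion ts; subst; congr bar.
  by case: (PO_order X) => _ _ anti; apply: anti.
- have := term_le_size ts; have := term_le_size st.
  by have := term_size_k j%:Z t => /=; lia.
- inversion ts; subst; last by rewrite IH.
  have /= := term_le_size H1; have := term_le_size st.
  by have := term_size_k i%:Z s; lia.
Qed.

Fixpoint indices_below (X : Type) (n : nat) (s : term X) : bool :=
  if s is theta i s' then (i < n)%N && indices_below n s' else true.

Definition in_Sn (X : Type) (n : nat) (s : term X) : bool :=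
  wf s && indices_below n s.

Definition in_S0n (X : Type) (n : nat) (s : term X) : bool :=
  in_Sn n s && (deg s <= 0).

Definition S0_car (n : nat) (X : Type) : Type := {s : term X | in_S0n n s}.

Definition S0_le (n : nat) (X : PO) : relation (S0_car n X) :=
  fun s t => term_le (val s) (val t).

Lemma S0_order (n : nat) (X : PO) :
  Relation_Definitions.order (S0_car n X) (@S0_le n X).
Proof.
split=> [s|s t u|s t].
- exact: term_le_refl.
- exact: term_le_trans.
- by move=> st ts; apply: val_inj; apply: term_le_antisym.
Qed.

Definition S0 (n : nat) (X : PO) : PO := MkPO (S0_order n X).

Fixpoint underk (X : Type) (s : term X) : X :=
  match s with
  | bar x => x
  | theta _ s' => underk s'
  end.

Lemma underkE (X : Type) (s : term X) : term_k (-1) s = bar (underk s).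
Proof. by elim: s => //= j s ->; case: ifP => //; lia. Qed.

Fixpoint term_map (X Y : Type) (f : X -> Y) (s : term X) : term Y :=
  match s with
  | bar x => bar (f x)
  | theta i s' => theta i (term_map f s')
  end.

Lemma deg_map (X Y : Type) (f : X -> Y) s : deg (term_map f s) = deg s.
Proof. by case: s. Qed.

Lemma in_S0n_map (X Y : Type) (f : X -> Y) n s :
  in_S0n n (term_map f s) = in_S0n n s.
Proof.
rewrite /in_S0n /in_Sn deg_map; congr (_ && _ && _).
  by elim: s => //= i s ->; rewrite deg_map.
by elim: s => //= i s ->.
Qed.

Lemma k_map (X Y : Type) (f : X -> Y) i s :
  term_k i (term_map f s) = term_map f (term_k i s).
Proof. by elim: s => //= j s ->; case: ifP. Qed.

Lemma underk_map (X Y : Type) (f : X -> Y) s :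
  underk (term_map f s) = f (underk s).
Proof. by elim: s. Qed.

Lemma term_map_quasi (X Y : PO) (f : X -> Y) : quasi_embedding f ->
  forall s t, term_le (term_map f s) (term_map f t) -> term_le s t.
Proof.
move=> qf s t; have [m] := ubnP (term_size s + term_size t)%N.
elim: m s t => // m IH s t sz.
have IHk s' j t' : (term_size s' + (term_size t').+1 < m.+1)%N ->
    term_le (term_map f s') (term_k j%:Z (term_map f t')) ->
    term_le s' (theta j t').
  move=> sz'; rewrite k_map => le; apply: term_le_k; apply: IH => //.
  by have := term_size_k j%:Z t'; lia.
case: s t sz => [x|i s] [y|j t] /= sz le; inversion le; subst.
- by apply: term_le_bar; apply: qf.
- exact: IHk.
- exact: IHk.
- by apply: term_le_theta; apply: IH => //; lia.
Qed.

Lemma term_map_mono (X Y : PO) (f : X -> Y) : embedding f ->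
  forall s t, term_le s t -> term_le (term_map f s) (term_map f t).
Proof.
move=> ef s t; elim=> [x y xy|{}s j {}t _ IH|i {}s {}t _ IH] /=.
- by apply: term_le_bar; apply/ef.
- by apply: term_le_k; rewrite k_map.
- exact: term_le_theta.
Qed.

Definition S0_map_fun (n : nat) (X Y : PO) (f : X -> Y) (s : S0 n X) : S0 n Y :=
  exist _ (term_map f (val s)) (etrans (in_S0n_map f n (val s)) (valP s)).

Lemma S0_map_quasi (n : nat) (X Y : PO) (f : qemb X Y) :
  quasi_embedding (@S0_map_fun n X Y f).
Proof. by move=> s t; apply: term_map_quasi; apply: qemb_quasi. Qed.

Definition S0_map (n : nat) (X Y : PO) (f : qemb X Y) : qemb (S0 n X) (S0 n Y) :=
  MkQemb (@S0_map_quasi n X Y f).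

Definition S0_supp (n : nat) (X : PO) (s : S0 n X) : set X :=
  [set underk (val s)].

Lemma S0_map_id (n : nat) (X : PO) : S0_map n (qemb_id X) =1 id.
Proof. by case=> s hs; apply: val_inj => /=; elim: s {hs} => //= i s ->. Qed.

Lemma S0_map_comp (n : nat) (X Y Z : PO) (g : qemb Y Z) (f : qemb X Y) :
  S0_map n (qemb_comp g f) =1 S0_map n g \o S0_map n f.
Proof. by case=> s hs; apply: val_inj => /=; elim: s {hs} => //= i s ->. Qed.

Lemma S0_map_embedding (n : nat) (X Y : PO) (f : qemb X Y) :
  embedding f -> embedding (S0_map n f).
Proof.
move=> ef s t; split; first exact: S0_map_quasi.
exact: (term_map_mono ef).
Qed.

Lemma S0_supp_finite (n : nat) (X : PO) (s : S0 n X) : finite_set (S0_supp s).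
Proof. exact: finite_set1. Qed.

Lemma S0_supp_natural (n : nat) (X Y : PO) (f : qemb X Y) (s : S0 n X) :
  S0_supp (S0_map n f s) = f @` S0_supp s.
Proof. by rewrite /S0_supp image_set1 /= underk_map. Qed.

Lemma S0_supp_range (n : nat) (X Y : PO) (f : qemb X Y) (s : S0 n Y) :
  embedding f -> S0_supp s `<=` range f -> range (S0_map n f) s.
Proof.
move=> _ /(_ _ erefl) [x _]; case: s => s hs /= fx.
suff [t def_s] : exists t, term_map f t = s.
  have ht : in_S0n n t by rewrite -(in_S0n_map f) def_s.
  by exists (exist _ t ht) => //; apply: val_inj.
elim: s fx {hs} => [y /= <-|i s IH /= /IH [t <-]]; first by exists (bar x).
by exists (theta i t).
Qed.

Definition S0_predilator (n : nat) : PO_dilator :=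
  @MkDilator (S0 n) (@S0_map n) (@S0_supp n) (@S0_map_id n) (@S0_map_comp n)
    (@S0_map_embedding n) (@S0_supp_finite n) (@S0_supp_natural n)
    (@S0_supp_range n).

Lemma S0_normal (n : nat) : normal (S0_predilator n).
Proof.
move=> X s t /(term_le_mono_k (-1)); rewrite !underkE => le x ->.
by exists (underk (val t)) => //; inversion le.
Qed.

Definition S0_dilator (n : nat) : normal_PO_dilator :=
  MkNormalDilator (@S0_normal n).

Fixpoint S0_sigma (n : nat) (X : PO) (s : term (S0 n.+1 X)) : term X :=
  match s with
  | bar r => val r
  | theta i s' => theta i.+1 (S0_sigma s')
  end.

Lemma deg_S0_sigma (n : nat) (X : PO) (s : term (S0 n.+1 X)) :
  deg (S0_sigma s) <= deg s + 1.
Proof. by case: s => [[r /= /andP[_ hr]]|i s] /=; lia. Qed.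

Lemma S0_sigma_in_Sn (n : nat) (X : PO) (s : term (S0 n.+1 X)) :
  in_Sn n s -> in_Sn n.+1 (S0_sigma s).
Proof.
elim: s => [[r /= /andP[]]//|i s IH] /andP[/= /andP[hi ws] /andP[lti bs]].
have /andP[ws' bs'] : in_Sn n.+1 (S0_sigma s) by apply: IH; rewrite /in_Sn ws bs.
have shift (a b : int) : a <= b + 1 -> Num.max (b - 1) 0 <= i%:Z ->
    Num.max (a - 1) 0 <= i.+1%:Z.
  by rewrite !ge_max; lia.
by rewrite /in_Sn /= ws' bs' !andbT ltnS lti andbT (shift _ _ (deg_S0_sigma s)).
Qed.

Lemma S0_kappa_subproof (n : nat) (X : PO) (s : S0 n (S0 n.+1 X)) :
  in_S0n n.+1 (theta 0 (S0_sigma (val s))).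
Proof.
case: s => s /= /andP[hs ds]; have /andP[ws bs] := S0_sigma_in_Sn hs.
have shift (a b : int) : a <= b + 1 -> b <= 0 -> Num.max (a - 1) 0 <= 0.
  by rewrite ge_max; lia.
by rewrite /in_S0n /in_Sn /= ws bs /= !andbT (shift _ _ (deg_S0_sigma s)).
Qed.

Definition S0_kappa (n : nat) (X : PO) (s : S0 n (S0 n.+1 X)) : S0 n.+1 X :=
  exist _ (theta 0 (S0_sigma (val s))) (S0_kappa_subproof s).

Definition S0_iota (n : nat) (X : PO) (x : X) : S0 n.+1 X :=
  exist _ (bar x) isT.

(* Main.v *)
Require Import Defs.
From mathcomp Require Import all_boot all_order all_algebra.
From mathcomp Require Import zify.
From mathcomp Require Import classical_sets.

(** The map [S0_sigma] is an order isomorphism of S_n(S^0_(n+1)(X)) onto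
    S_(n+1)(X): every index is raised by one, and what lies below the indices
    greater than zero is a leaf.  Since it turns [term_k i] into
    [term_k (i + 1)], the collapse [term_k 0] on its image reads off the unique
    element of the support, so that the clauses of a Kruskal fixed point become
    those that define [term_le].  The inverse isomorphism allows us to define
    the morphism into another fixed point by structural recursion on terms. *)

Set Implicit Arguments.
Unset Strict Implicit.
Unset Printing Implicit Defensive.

Import Order.TTheory GRing.Theory Num.Theory.

Local Open Scope classical_set_scope.
Local Open Scope ring_scope.

Lemma term_k_id (X : Type) (i : int) (s : term X) : deg s <= i -> term_k i s = s.
Proof. by case: s => //= j s ->. Qed.

Lemma deg_term_k (X : Type) (j : nat) (s : term X) : deg (term_k j%:Z s) <= j%:Z.
Proof. by elim: s => //= i s IH; case: ifP. Qed.

Lemma underk_term_k (X : Type) (i : int) (s : term X) :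
  underk (term_k i s) = underk s.
Proof. by elim: s => //= j s IH; case: ifP. Qed.

(** In the clause [term_le_k], the collapse to level [j] has degree at most [j]. *)
Lemma term_le_deg (X : PO) (s t : term X) : term_le s t -> deg s <= deg t.
Proof.
elim=> //= {}s j {}t _ le_s; exact: le_trans le_s (deg_term_k _ _).
Qed.

Lemma term_le_barE (X : PO) (x y : X) : term_le (bar x) (bar y) <-> x ⊑ y.
Proof. by split=> [le|]; [inversion le | exact: term_le_bar]. Qed.

Lemma term_le_bar_theta (X : PO) (x : X) (j : nat) (t : term X) :
  term_le (bar x) (theta j t) <-> term_le (bar x) (term_k j%:Z t).
Proof. by split=> [le|]; [inversion le | exact: term_le_k]. Qed.

Lemma not_term_le_theta_bar (X : PO) (i : nat) (s : term X) (y : X) :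
  ~ term_le (theta i s) (bar y).
Proof. by move=> /term_le_deg. Qed.

Lemma term_le_thetaE (X : PO) (i : nat) (s t : term X) :
  term_le (theta i s) (theta i t) <->
  (term_le s t \/ term_le (theta i s) (term_k i%:Z t)).
Proof.
split=> [le|[]]; [|exact: term_le_theta|exact: term_le_k].
by inversion le; [right | left].
Qed.

(** A term has a single leaf, so its image depends only on the value of the map there; uniqueness of
    the morphism rests on this. *)
Lemma eq_term_map_underk (X Y : Type) (f g : X -> Y) (s : term X) :
  f (underk s) = g (underk s) -> term_map f s = term_map g s.
Proof. by elim: s => /= [x ->|i s IH /IH ->]. Qed.

(** The condition on [f] concerns the two leaves only, so that an induction hypothesis can supply it
    before [f] is known to be a quasi embedding. *)
Lemma term_map_quasi_underk (X Y : PO) (f : X -> Y) (s t : term X) :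
  (f (underk s) ⊑ f (underk t) -> underk s ⊑ underk t) ->
  term_le (term_map f s) (term_map f t) -> term_le s t.
Proof.
have [m] := ubnP (term_size s + term_size t)%N.
elim: m s t => // m IH s t sz qf.
have IHk j t' : t = theta j t' ->
    term_le (term_map f s) (term_k j%:Z (term_map f t')) -> term_le s t.
  move=> def_t; rewrite def_t /= in sz qf *; rewrite k_map => le.
  (* Collapsing keeps the leaf, hence also the condition on [f]. *)
  apply: term_le_k; apply: IH le; last by rewrite underk_term_k.
  by have := term_size_k j%:Z t'; lia.
case: s t sz qf IHk => [x|i s] [y|j t] /= sz qf IHk le; inversion le; subst.
- by apply: term_le_bar; apply: qf.
- exact: (IHk j t).
- exact: (IHk j t).
- by apply: term_le_theta; apply: IH => //; lia.
Qed.

Definition S0_Sub (n : nat) (X : PO) (s : term X) (hs : in_S0n n s) : S0 n X :=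
  exist _ s hs.

Lemma S0_deg (n : nat) (X : PO) (r : S0 n X) : deg (val r) <= 0.
Proof. by case: r => r /= /andP[]. Qed.

Section Sigma.

Variables (n : nat) (X : PO).
Implicit Types (s t : term (S0 n.+1 X)) (r : S0 n.+1 X).

Lemma term_k_sigma (i : int) s : -1 <= i ->
  term_k (i + 1) (S0_sigma s) = S0_sigma (term_k i s).
Proof.
move=> i_ge; elim: s => [r|j s IH] /=.
  (* A leaf has degree at most 0, hence at most [i + 1], and is not collapsed. *)
  by rewrite term_k_id //; apply: le_trans (S0_deg r) _; lia.
rewrite IH (_ : (j.+1%:Z <= i + 1) = (j%:Z <= i)); last by lia.
by case: ifP.
Qed.

Lemma term_k0_sigma s : term_k 0 (S0_sigma s) = val (underk s).
Proof. by have := @term_k_sigma (-1) s; rewrite addNr underkE; apply. Qed.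

Lemma sigma_le s t : term_le (S0_sigma s) (S0_sigma t) <-> term_le s t.
Proof.
have [m] := ubnP (term_size s + term_size t)%N.
elim: m s t => // m IH s t sz.
case: t sz => [r'|j t] sz.
  case: s sz => [r|i s] _; first by rewrite term_le_barE.
  split=> [|/not_term_le_theta_bar //].
  (* The image of a [theta] has positive degree, the leaf [r'] does not. *)
  by move=> /= /term_le_deg /le_trans /(_ (S0_deg r')).
have IHk : term_le (S0_sigma s) (term_k j.+1%:Z (S0_sigma t)) <->
    term_le s (term_k j%:Z t).
  rewrite (_ : j.+1%:Z = j%:Z + 1); last by lia.
  rewrite term_k_sigma //; apply: IH.
  by have := term_size_k j%:Z t; move: sz => /=; lia.
case: s sz IHk => [r|i s] sz IHk; split=> /= le.
- apply: term_le_k; apply/IHk; have /= := S0_deg r.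
  (* The clause [term_le_theta] would give [r] the index [j.+1], against its degree. *)
  by inversion le as [|? ? ? le'|? ? ? le' E] => //=; rewrite -E.
- by apply: term_le_k; apply/IHk; inversion le.
- inversion le; subst; first by apply: term_le_k; apply/IHk.
  by apply: term_le_theta; apply/IH => //; move: sz => /=; lia.
- inversion le; subst; first by apply: term_le_k; apply/IHk.
  by apply: term_le_theta; apply/IH => //; move: sz => /=; lia.
Qed.

(* The bound on the degree holds for the preimage built here: a term of degree
   at most zero is the image of a leaf. *)
Lemma sigma_surj (u : term X) : in_Sn n.+1 u ->
  exists2 s : term (S0 n.+1 X), in_Sn n s /\ deg s <= Num.max (deg u - 1) (-1) &
    S0_sigma s = u.
Proof.
elim: u => [x|i u IH] hu.
  by exists (bar (S0_iota n x)).
case: i hu => [|i] hu.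
  have hr : in_S0n n.+1 (theta 0 u) by rewrite /in_S0n hu.
  by exists (bar (S0_Sub hr)).
move: hu => /andP[/= /andP[hi wu] /andP[lti bu]].
have [|s [/andP[ws bs] ds] <-] := IH; first by rewrite /in_Sn wu bu.
exists (theta i s) => //; split; last by rewrite le_max /=; lia.
have shift (a b : int) : b <= Num.max (a - 1) (-1) ->
    Num.max (a - 1) 0 <= i.+1%:Z -> Num.max (b - 1) 0 <= i%:Z.
  by rewrite le_max !ge_max; lia.
by rewrite /in_Sn /= ws bs -ltnS lti !andbT; apply: shift ds hi.
Qed.

Variant S0_spec : S0 n.+1 X -> Prop :=
| S0_spec_iota (x : X) : S0_spec (S0_iota n x)
| S0_spec_kappa (s : S0 n (S0 n.+1 X)) : S0_spec (S0_kappa s).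

(** Below an index 0, a well-formed term has degree at most 1, so its preimage under [S0_sigma] has
    degree at most 0, as the domain of [S0_kappa] requires. *)
Lemma S0P (z : S0 n.+1 X) : S0_spec z.
Proof.
case: z => [[x|i u] hz].
  by rewrite (_ : exist _ _ _ = S0_iota n x); [left | apply: val_inj].
have /andP[/andP[/= /andP[hi wu] /andP[_ bu]] i0] := hz.
have [|s [hs ds] def_u] := @sigma_surj u; first by rewrite /in_Sn wu bu.
have shift (a b : int) : b <= Num.max (a - 1) (-1) ->
    Num.max (a - 1) 0 <= i%:Z -> i%:Z <= 0 -> b <= 0.
  by rewrite le_max ge_max; lia.
have hs0 : in_S0n n s by rewrite /in_S0n hs /=; apply: shift ds hi i0.
rewrite (_ : exist _ _ _ = S0_kappa (S0_Sub hs0)); first by right.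
by apply: val_inj => /=; rewrite def_u; congr theta; lia.
Qed.

(** Size serves as the height function of the initial fixed point. *)
Lemma term_size_underk_kappa (s : S0 n (S0 n.+1 X)) :
  (term_size (val (underk (val s))) < term_size (val (S0_kappa s)))%N.
Proof. by rewrite /= ltnS -term_k0_sigma term_size_k. Qed.

Lemma S0_ind (P : S0 n.+1 X -> Prop) :
  (forall x, P (S0_iota n x)) ->
  (forall s : S0 n (S0 n.+1 X), P (underk (val s)) -> P (S0_kappa s)) ->
  forall z, P z.
Proof.
move=> Piota Pkappa z; have [m] := ubnP (term_size (val z)).
elim: m z => // m IH z; case: (S0P z) => // s sz.
by apply: Pkappa; apply: IH; apply: leq_trans (term_size_underk_kappa s) _.
Qed.

Lemma exists_S0_supp (m : nat) (Y : PO) (s : S0 m Y) (P : Y -> Prop) :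
  (exists2 z, S0_supp s z & P z) <-> P (underk (val s)).
Proof. by split=> [[z ->]|Ps] //; exists (underk (val s)). Qed.

Lemma S0_kruskal_fixed_point :
  @kruskal_fixed_point (S0_dilator n) X (S0 n.+1 X)
    (@S0_iota n X) (@S0_kappa n X).
Proof.
split=> [x y|x t|s y|s t].
- exact: term_le_barE.
- rewrite (exists_S0_supp t) /= /S0_le /=.
  by rewrite term_le_bar_theta term_k0_sigma.
- exact: not_term_le_theta_bar.
- rewrite (exists_S0_supp t) /= /S0_le /=.
  by rewrite term_le_thetaE term_k0_sigma sigma_le.
Qed.

End Sigma.

Section Recursor.

Variables (n : nat) (X Z : PO) (iota : X -> Z) (kappa : S0 n Z -> Z).

Definition S0_bar (z : Z) : S0 n Z := exist _ (bar z) isT.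

(* The composition of [term_map S0_rec] with the inverse of [S0_sigma]; the
   default value of [insubd] is irrelevant on well-formed terms. *)
Fixpoint unsigma_rec (u : term X) : term Z :=
  match u with
  | bar x => bar (iota x)
  | theta 0 u' =>
      bar (kappa (insubd (S0_bar (iota (underk u'))) (unsigma_rec u')))
  | theta i.+1 u' => theta i (unsigma_rec u')
  end.

Definition S0_rec (z : S0 n.+1 X) : Z := underk (unsigma_rec (val z)).

Lemma unsigma_rec_sigma (s : term (S0 n.+1 X)) :
  unsigma_rec (S0_sigma s) = term_map S0_rec s.
Proof.
elim: s => [r|i s /= -> //]; have := S0_deg r.
(* By its degree, [r] is a [bar] or has index 0; [unsigma_rec] turns both into leaves. *)
by case: r => [[x|[|i] u]].
Qed.

(** Stated with [S0_map_fun], since the proof that [S0_rec] is a quasi embedding uses this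
    equation. *)
Lemma S0_rec_kappa (s : S0 n (S0 n.+1 X)) :
  S0_rec (S0_kappa s) = kappa (S0_map_fun S0_rec s).
Proof.
rewrite {1}/S0_rec /= unsigma_rec_sigma; congr kappa; apply: val_inj.
by rewrite val_insubd in_S0n_map (valP s).
Qed.

Hypothesis fixZ : @kruskal_fixed_point (S0_dilator n) X Z iota kappa.

Lemma S0_rec_quasi : @quasi_embedding (S0 n.+1 X) Z S0_rec.
Proof.
have fixX := S0_kruskal_fixed_point n X.
move=> z w; have [m] := ubnP (term_size (val z) + term_size (val w))%N.
elim: m z w => // m IH z w.
case: (S0P z) => [x|s]; case: (S0P w) => [y|t] sz.
- by move/(kfp_iota_iota fixZ)=> xy; apply/(kfp_iota_iota fixX).
- rewrite S0_rec_kappa => /(kfp_iota_kappa fixZ)/exists_S0_supp.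
  rewrite /= underk_map => le.
  apply/(kfp_iota_kappa fixX)/exists_S0_supp.
  apply: (IH (S0_iota n x) _ _ le).
  by move: sz (term_size_underk_kappa t) => /=; lia.
- by rewrite S0_rec_kappa => /(kfp_kappa_iota fixZ).
- rewrite 2!S0_rec_kappa => /(kfp_kappa_kappa fixZ) le.
  apply/(kfp_kappa_kappa fixX); rewrite (exists_S0_supp t).
  case: le => [le|/exists_S0_supp le]; [left | right].
    (* Only the leaves of [s] and [t] need comparing, and both are smaller than the terms [z] and
       [w]. *)
    apply: (term_map_quasi_underk _ le) => le'; apply: IH le'.
    move: sz (term_size_underk_kappa s) (term_size_underk_kappa t) => /=; lia.
  apply: (IH (S0_kappa s)).
    by move: sz (term_size_underk_kappa t) => /=; lia.
  by rewrite S0_rec_kappa; move: le; rewrite /= underk_map.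
Qed.

End Recursor.

Lemma S0_initial (n : nat) (X : PO) :
  @initial_kruskal_fixed_point (S0_dilator n) X (S0 n.+1 X)
    (@S0_iota n X) (@S0_kappa n X).
Proof.
split=> [|Z iota kappa fixZ]; first exact: S0_kruskal_fixed_point.
exists (MkQemb (S0_rec_quasi fixZ)).
  by split=> // s; apply: S0_rec_kappa.
move=> g [g_iota g_kappa]; apply: S0_ind => [x|s IH]; first exact: g_iota.
have /= -> := g_kappa s; rewrite S0_rec_kappa; congr kappa; apply: val_inj.
exact: eq_term_map_underk.
Qed.

(** Naturality of [S0_sigma], which yields that of [S0_kappa]. *)
Lemma term_map_sigma (n : nat) (X Y : PO) (f : qemb X Y) (s : term (S0 n.+1 X)) :
  term_map f (S0_sigma s) = S0_sigma (term_map (S0_map n.+1 f) s).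
Proof. by elim: s => //= i s ->. Qed.

Theorem theorem5p9 (n : nat) :
  @is_kruskal_derivative (S0_dilator n) (S0_dilator (S n)) (@S0_iota n) (@S0_kappa n).
Proof.
split=> [X|X Y f]; first exact: S0_initial.
split=> [x|s]; apply: val_inj => //=.
by rewrite term_map_sigma.
Qed.
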